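(* Let $\mathcal{M}$ be a Type $\mathcal{B}$ surface. Then $\mathcal{M}$ is strongly projectively flat if and only if $\mathcal{M}$ is linearly equivalent to one of the surfaces: \begin{enumerate} \item $C_{12}{}^1=C_{22}{}^1=C_{22}{}^2=0$ (i.e. $\mathcal{M}$ is also of Type $\mathcal{A}$). \item $C_{11}{}^1=1+2v$, $C_{11}{}^2=0$, $C_{12}{}^1=0$, $C_{12}{}^2=v$, $C_{22}{}^1=\pm1$, $C_{22}{}^2=0$, for some $v\in\mathbb{R}$ and some choice of sign. \end{enumerate}
   Context: A Type $\mathcal{B}$ surface is $M=\mathbb{R}^+\times\mathbb{R}$ with coordinates $(x^1,x^2)$, $x^1>0$, and a torsion free connection $\nabla$, $\nabla_{\partial_{x^i}}\partial_{x^j}=\Gamma_{ij}{}^k\partial_{x^k}$, with Christoffel symbols $\Gamma_{ij}{}^k=(x^1)^{-1}C_{ij}{}^k$ where $C_{ij}{}^k=C_{ji}{}^k\in\mathbb{R}$ are constants, and which is not flat (equivalently its Ricci tensor $\rho_\nabla$, $\rho_\nabla(x,y)=\operatorname{Tr}\{z\mapsto R_\nabla(z,x)y\}$ with $R_\nabla(x,y)=\nabla_x\nabla_y-\nabla_y\nabla_x-\nabla_{[x,y]}$, does not vanish identically). Two Type $\mathcal{B}$ surfaces are linearly equivalent if they are intertwined by some map $(x^1,x^2)\mapsto(x^1,ax^1+bx^2)$ with $a,b\in\mathbb{R}$, $b\neq0$. A surface is also of Type $\mathcal{A}$ if it admits a coordinate atlas in which all Christoffel symbols are constant. Two connections $\nabla,\tilde\nabla$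 are strongly projectively equivalent if there is a closed $1$-form $\omega$ with $\nabla_XY=\tilde\nabla_XY+\omega(X)Y+\omega(Y)X$ for all $X,Y$. The surface is strongly projectively flat if (locally) $\nabla$ is strongly projectively equivalent to a flat torsion free connection. *)

(* Defs.v *)
From Stdlib Require Import Reals.
From Coquelicot Require Import Coquelicot.
Open Scope R_scope.

Inductive idx : Set := i1 | i2.

Definition idx_eqb (i j : idx) : bool :=
  match i, j with i1, i1 | i2, i2 => true | _, _ => false end.

Definition kron (i j : idx) : R := if idx_eqb i j then 1 else 0.

Definition sumI (f : idx -> R) : R := f i1 + f i2.

(** Scalar functions are curried in the coordinates (x^1, x^2). They are total;
    only their values on the open set under consideration matter. *)
Definition scal := R -> R -> R.
Definition vfield := idx -> scal.
Definition form1 := idx -> scal.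

(** [G i j k] is the Christoffel symbol Gamma_{ij}^k. *)
Definition christoffel := idx -> idx -> idx -> scal.

Definition partial (i : idx) (f : scal) : scal :=
  match i with
  | i1 => fun x y => Derive (fun t => f t y) x
  | i2 => fun x y => Derive (fun t => f x t) y
  end.

(** C^infinity on [U] (intended for open [U]): [ex_diff_n f n x y] says that
    every iterated partial derivative of order at most [n] exists and is
    continuous at (x, y). *)
Definition smooth_on (U : R * R -> Prop) (f : scal) : Prop :=
  forall x y, U (x, y) -> forall n, ex_diff_n f n x y.

Definition torsion_free_connection (U : R * R -> Prop) (G : christoffel) : Prop :=
  (forall i j k, smooth_on U (G i j k)) /\
  (forall i j k x y, U (x, y) -> G i j k x y = G j i k x y).

(** (nabla_X Y)^k = X^i (d_i Y^k + Gamma_{ij}^k Y^j). *)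
Definition cov_deriv (G : christoffel) (X Y : vfield) : vfield :=
  fun k x y =>
    sumI (fun i => X i x y *
      (partial i (Y k) x y + sumI (fun j => G i j k x y * Y j x y))).

(** The l-th component of R(d_i, d_j) d_k, where
    R(X, Y) = nabla_X nabla_Y - nabla_Y nabla_X - nabla_[X,Y]. *)
Definition curvature (G : christoffel) (i j k l : idx) : scal :=
  fun x y =>
    partial i (G j k l) x y - partial j (G i k l) x y
    + sumI (fun m => G j k m x y * G i m l x y)
    - sumI (fun m => G i k m x y * G j m l x y).

Definition flat_on (U : R * R -> Prop) (G : christoffel) : Prop :=
  forall i j k l x y, U (x, y) -> curvature G i j k l x y = 0.

Definition closed_form (U : R * R -> Prop) (w : form1) : Prop :=
  forall i j x y, U (x, y) -> partial i (w j) x y = partial j (w i) x y.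

Definition pairing (w : form1) (X : vfield) : scal :=
  fun x y => sumI (fun i => w i x y * X i x y).

Definition strongly_proj_equiv (U : R * R -> Prop) (G G' : christoffel) : Prop :=
  exists w : form1,
    (forall i, smooth_on U (w i)) /\ closed_form U w /\
    forall X Y : vfield,
      (forall i, smooth_on U (X i)) -> (forall i, smooth_on U (Y i)) ->
      forall k x y, U (x, y) ->
        cov_deriv G X Y k x y =
        cov_deriv G' X Y k x y
        + pairing w X x y * Y k x y + pairing w Y x y * X k x y.

Definition strongly_proj_flat (M : R * R -> Prop) (G : christoffel) : Prop :=
  forall p, M p ->
  exists (U : R * R -> Prop) (G' : christoffel),
    open U /\ U p /\ (forall q, U q -> M q) /\
    torsion_free_connection U G' /\ flat_on U G' /\
    strongly_proj_equiv U G G'.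

(** phi_* (nabla_{d_i} d_j) = nabla'_{phi_* d_i} (phi_* d_j) at every point
    of [U], written in components. *)
Definition intertwines (U : R * R -> Prop) (G G' : christoffel)
    (phi : idx -> scal) : Prop :=
  forall i j c x y, U (x, y) ->
    sumI (fun k => G i j k x y * partial k (phi c) x y) =
    partial i (partial j (phi c)) x y
    + sumI (fun a => sumI (fun b =>
        G' a b c (phi i1 x y) (phi i2 x y)
        * partial i (phi a) x y * partial j (phi b) x y)).

Definition maps_to (U V : R * R -> Prop) (phi : idx -> scal) : Prop :=
  forall x y, U (x, y) -> V (phi i1 x y, phi i2 x y).

Definition diffeo (U V : R * R -> Prop) (phi : idx -> scal) : Prop :=
  (forall i, smooth_on U (phi i)) /\ maps_to U V phi /\
  exists psi : idx -> scal,
    (forall i, smooth_on V (psi i)) /\ maps_to V U psi /\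
    (forall x y, U (x, y) ->
       psi i1 (phi i1 x y) (phi i2 x y) = x /\
       psi i2 (phi i1 x y) (phi i2 x y) = y) /\
    (forall u v, V (u, v) ->
       phi i1 (psi i1 u v) (psi i2 u v) = u /\
       phi i2 (psi i1 u v) (psi i2 u v) = v).

(** The chart [phi : U -> V] around each point puts the connection in the form
    of the constant Christoffel symbols [A] on [V]. *)
Definition is_typeA (M : R * R -> Prop) (G : christoffel) : Prop :=
  forall p, M p ->
  exists (U V : R * R -> Prop) (phi : idx -> scal) (A : idx -> idx -> idx -> R),
    open U /\ U p /\ (forall q, U q -> M q) /\ open V /\
    diffeo U V phi /\
    intertwines U G (fun a b c _ _ => A a b c) phi.

Definition half_plane (p : R * R) : Prop := 0 < fst p.

(** [C i j k] is the constant C_{ij}^k. *)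
Definition typeB_coef := idx -> idx -> idx -> R.

Definition typeB_christoffel (C : typeB_coef) : christoffel :=
  fun i j k x _ => / x * C i j k.

Definition is_typeB (C : typeB_coef) : Prop :=
  (forall i j k, C i j k = C j i k) /\
  ~ flat_on half_plane (typeB_christoffel C).

Definition linear_map (a b : R) (i : idx) : scal :=
  match i with
  | i1 => fun x _ => x
  | i2 => fun x y => a * x + b * y
  end.

Definition linearly_equiv (C C' : typeB_coef) : Prop :=
  exists a b : R, b <> 0 /\
    intertwines half_plane (typeB_christoffel C) (typeB_christoffel C')
      (linear_map a b).

Definition family1 (C : typeB_coef) : Prop :=
  C i1 i2 i1 = 0 /\ C i2 i2 i1 = 0 /\ C i2 i2 i2 = 0.

Definition family2 (v : R) (C : typeB_coef) : Prop :=
  C i1 i1 i1 = 1 + 2 * v /\ C i1 i1 i2 = 0 /\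
  C i1 i2 i1 = 0 /\ C i1 i2 i2 = v /\
  (C i2 i2 i1 = 1 \/ C i2 i2 i1 = -1) /\ C i2 i2 i2 = 0.

(* Main.v *)
(** In dimension two [R(d_1, d_2) d_k = rho_2k d_1 - rho_1k d_2], so everything is
    encoded in the Ricci tensor, which for a Type B surface is [Q / (x^1)^2] with
    [Q] constant.

    A strong projective equivalence to a flat connection amounts to
    [d_i w_j = Gamma_ij^k w_k - w_i w_j - rho_ij] with [rho] symmetric, and the
    integrability condition of this system is the Codazzi equation for [rho],
    which no longer involves [w]. Together with the symmetry of [Q] the Codazzi
    equation is polynomial in the [C_ij^k]; after the linear change making
    [C_12^1] vanish it yields the two families. Conversely
    [w = (C_12^2 / x^1) dx^1] for the first family, and [w = (v / x^1) dx^1] for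
    the second, leads to a flat connection.

    If there is a chart [phi] with constant Christoffel symbols [A], then [rho] is
    the pullback of a constant form, and symmetry and the Codazzi equation are
    inherited from polynomial identities in [A]. As [Q / (x^1)^2] is then a flat
    (possibly degenerate) metric, [Q_22 = 0], which excludes the second family.
    For the first family [(ln x^1, x^2 + h(x^1))] is such a chart, for a suitable
    [h]. *)

Require Import Defs.
From Stdlib Require Import Reals Lra.
From Coquelicot Require Import Coquelicot.
Open Scope R_scope.

(** * Partial derivatives and smooth functions *)

(** A relation, so that derivative rules carry existence: the total [partial] has a value even where
    no derivative exists. *)
Definition is_partial (i : idx) (f : Defs.scal) (x y l : R) : Prop :=
  match i with
  | i1 => is_derive (fun t => f t y) x l
  | i2 => is_derive (fun t => f x t) y l
  end.

Lemma partial_unique i f x y l : is_partial i f x y l -> partial i f x y = l.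
Proof. destruct i; apply is_derive_unique. Qed.

Lemma is_partial_const i k x y : is_partial i (fun _ _ => k) x y 0.
Proof. destruct i; apply (is_derive_const k). Qed.

Lemma is_partial_plus i f g x y l m :
  is_partial i f x y l -> is_partial i g x y m ->
  is_partial i (fun x y => f x y + g x y) x y (l + m).
Proof.
  destruct i; simpl; intros Hf Hg.
  - exact (is_derive_plus _ _ _ _ _ Hf Hg).
  - exact (is_derive_plus _ _ _ _ _ Hf Hg).
 Qed.

Lemma is_partial_minus i f g x y l m :
  is_partial i f x y l -> is_partial i g x y m ->
  is_partial i (fun x y => f x y - g x y) x y (l - m).
Proof.
  destruct i; simpl; intros Hf Hg.
  - exact (is_derive_minus _ _ _ _ _ Hf Hg).
  - exact (is_derive_minus _ _ _ _ _ Hf Hg).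
 Qed.

Lemma is_partial_mult i f g x y l m :
  is_partial i f x y l -> is_partial i g x y m ->
  is_partial i (fun x y => f x y * g x y) x y (l * g x y + f x y * m).
Proof.
  destruct i; simpl; intros Hf Hg.
  - exact (is_derive_mult _ _ _ _ _ Hf Hg Rmult_comm).
  - exact (is_derive_mult _ _ _ _ _ Hf Hg Rmult_comm).
Qed.

Lemma is_partial_fst i (f : R -> R) x y l :
  is_derive f x l -> is_partial i (fun x _ => f x) x y (kron i i1 * l).
Proof.
  destruct i; unfold kron; simpl; intros H.
  - now rewrite Rmult_1_l.
  - rewrite Rmult_0_l; apply (is_derive_const (f x)).
Qed.

Lemma is_partial_inv i x y :
  x <> 0 -> is_partial i (fun x _ => / x) x y (kron i i1 * - (/ x * / x)).
Proof. intros H; apply is_partial_fst; auto_derive; [easy | field; easy]. Qed.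

Lemma is_partial_eq i f x y l m :
  is_partial i f x y l -> l = m -> is_partial i f x y m.
Proof. now intros H <-. Qed.

Ltac split_partial :=
  lazymatch goal with
  | |- is_partial _ (fun x y => @?f x y + @?g x y) _ _ _ =>
      apply (is_partial_plus _ f g); split_partial
  | |- is_partial _ (fun x y => @?f x y - @?g x y) _ _ _ =>
      apply (is_partial_minus _ f g); split_partial
  | |- is_partial _ (fun x y => @?f x y * @?g x y) _ _ _ =>
      apply (is_partial_mult _ f g); split_partial
  | |- is_partial _ (fun x _ => / x) _ _ _ => apply is_partial_inv
  | |- is_partial _ (fun _ _ => ?k) _ _ _ => apply (is_partial_const _ k)
  | |- _ => idtac
  end.

(** * Locality and smooth functions *)

Lemma open_near (U : R * R -> Prop) x y :
  open U -> U (x, y) -> locally_2d (fun u v => U (u, v)) x y.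
Proof.
  intros HU Hp; apply locally_2d_locally.
  apply (filter_imp U); [now intros [u v] | now apply HU].
Qed.

Lemma open_near_line i (U : R * R -> Prop) x y :
  open U -> U (x, y) ->
  match i with
  | i1 => locally x (fun t => U (t, y))
  | i2 => locally y (fun t => U (x, t))
  end.
Proof.
  intros HU Hp; generalize (open_near U x y HU Hp); destruct i.
  - apply locally_2d_1d_const_y.
  - apply locally_2d_1d_const_x.
Qed.

(** Differentiation is local: an identity known only on the open set [U] may be differentiated
    there. *)
Lemma is_partial_ext i (U : R * R -> Prop) f g x y l :
  open U -> U (x, y) -> (forall u v, U (u, v) -> f u v = g u v) ->
  is_partial i f x y l -> is_partial i g x y l.
Proof.
  intros HU Hp E H; generalize (open_near_line i U x y HU Hp).
  destruct i; intros L; refine (is_derive_ext_loc _ _ _ _ _ H);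
    revert L; apply filter_imp; intros t Ht; now apply E.
Qed.

Lemma smooth_is_partial i U f x y :
  smooth_on U f -> U (x, y) -> is_partial i f x y (partial i f x y).
Proof.
  intros S Hp; destruct (S x y Hp 1%nat) as (_ & D1 & D2 & _).
  destruct i; now apply Derive_correct.
Qed.

Lemma smooth_partial i U f : smooth_on U f -> smooth_on U (partial i f).
Proof.
  intros S x y Hp n; destruct (S x y Hp (Datatypes.S n)) as (_ & _ & _ & D1 & D2).
  now destruct i.
Qed.

Lemma smooth_continuity U f x y :
  smooth_on U f -> U (x, y) -> continuity_2d_pt f x y.
Proof. intros S Hp; exact (proj1 (S x y Hp 0%nat)). Qed.

Lemma partial_comm i j U f x y :
  open U -> smooth_on U f -> U (x, y) ->
  partial i (partial j f) x y = partial j (partial i f) x y.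
Proof.
  intros HU S Hp.
  assert (E : partial i1 (partial i2 f) x y = partial i2 (partial i1 f) x y).
  { apply Schwarz.
    - destruct (open_near U x y HU Hp) as [eps L]; exists eps; intros u v Hu Hv.
      assert (Q := L u v Hu Hv).
      destruct (S u v Q 2%nat) as (_ & D1 & D2 & (_ & _ & D12 & _) & (_ & D21 & _)).
      now repeat split.
    - exact (smooth_continuity U _ x y
               (smooth_partial i1 _ _ (smooth_partial i2 _ _ S)) Hp).
    - exact (smooth_continuity U _ x y
               (smooth_partial i2 _ _ (smooth_partial i1 _ _ S)) Hp). }
  destruct i, j; trivial; now symmetry.
Qed.

Lemma smooth_differentiable U f x y :
  open U -> smooth_on U f -> U (x, y) ->
  differentiable_pt_lim f x y (partial i1 f x y) (partial i2 f x y).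
Proof.
  intros HU S Hp; apply filterdiff_differentiable_pt_lim.
  apply (is_derive_filterdiff f x y (partial i1 f) (partial i2 f x y)).
  - apply (filter_imp U); [ | now apply HU].
    intros [u v] Hu; exact (smooth_is_partial i1 U f u v S Hu).
  - exact (smooth_is_partial i2 U f x y S Hp).
  - apply continuity_2d_pt_filterlim.
    exact (smooth_continuity U _ x y (smooth_partial i1 _ _ S) Hp).
Qed.

(** Closed under partial derivatives, hence consisting of smooth functions. *)
Inductive elementary (U : R * R -> Prop) : Defs.scal -> Prop :=
| el_const k : elementary U (fun _ _ => k)
| el_snd : elementary U (fun _ y => y)
| el_plus f g : elementary U f -> elementary U g ->
    elementary U (fun x y => f x y + g x y)
| el_mult f g : elementary U f -> elementary U g ->
    elementary U (fun x y => f x y * g x y)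
| el_fst : elementary U (fun x _ => x)
| el_exp : elementary U (fun x _ => exp x)
| el_inv : (forall x y, U (x, y) -> 0 < x) -> elementary U (fun x _ => / x)
| el_ln : (forall x y, U (x, y) -> 0 < x) -> elementary U (fun x _ => ln x).

Lemma elementary_partial U f i : elementary U f ->
  exists g, elementary U g /\ forall x y, U (x, y) -> is_partial i f x y (g x y).
Proof.
  induction 1 as [k | | f g _ (f' & Ef & Hf) _ (g' & Eg & Hg)
                 | f g If (f' & Ef & Hf) Ig (g' & Eg & Hg) | | | P | P].
  - exists (fun _ _ => 0); split; [constructor | intros; apply is_partial_const].
  - exists (fun _ _ => kron i i2); split; [constructor | ].
    intros x y _; destruct i; unfold kron; simpl.
    + apply (is_derive_const y).
    + apply (is_derive_id y).
  - exists (fun x y => f' x y + g' x y); split; [now constructor | ].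
    intros; apply is_partial_plus; auto.
  - exists (fun x y => f' x y * g x y + f x y * g' x y); split;
      [now repeat constructor | ].
    intros; apply is_partial_mult; auto.
  - exists (fun _ _ => kron i i1 * 1); split; [constructor | ].
    intros; apply (is_partial_fst i (fun x => x)), (is_derive_id x).
  - exists (fun x _ => kron i i1 * exp x); split; [repeat constructor | ].
    intros; apply is_partial_fst, is_derive_exp.
  - exists (fun x _ => kron i i1 * (-1 * (/ x * / x))); split;
      [now repeat constructor | ].
    intros x y Hp; specialize (P x y Hp).
    apply is_partial_fst; auto_derive; [lra | field; lra].
  - exists (fun x _ => kron i i1 * / x); split; [now repeat constructor | ].
    intros x y Hp; apply is_partial_fst, is_derive_ln, (P x y Hp).
Qed.

Lemma elementary_continuity U f x y :
  elementary U f -> U (x, y) -> continuity_2d_pt f x y.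
Proof.
  intros E Hp; induction E as [k | | f g _ Hf _ Hg | f g _ Hf _ Hg | | | P | P].
  - apply continuity_2d_pt_const.
  - apply continuity_2d_pt_id2.
  - now apply continuity_2d_pt_plus.
  - now apply continuity_2d_pt_mult.
  - apply continuity_2d_pt_id1.
  - apply (continuity_1d_2d_pt_comp exp (fun x _ => x)).
    + apply derivable_continuous_pt, derivable_pt_exp.
    + apply continuity_2d_pt_id1.
  - apply (continuity_2d_pt_inv (fun x _ => x)); [apply continuity_2d_pt_id1 | ].
    specialize (P x y Hp); lra.
  - apply (continuity_1d_2d_pt_comp ln (fun x _ => x)).
    + apply derivable_continuous_pt; exists (/ x).
      exact (derivable_pt_lim_ln x (P x y Hp)).
    + apply continuity_2d_pt_id1.
Qed.

Lemma elementary_smooth U f : open U -> elementary U f -> smooth_on U f.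
Proof.
  (* The induction on the order quantifies over [f], since its step passes to the partial
     derivatives, again elementary. *)
  intros HU E x y Hp n; revert f E x y Hp; induction n as [ | n IH];
    intros f E x y Hp; (split; [exact (elementary_continuity U f x y E Hp) | ]);
    trivial.
  destruct (elementary_partial U f i1 E) as (g1 & E1 & D1).
  destruct (elementary_partial U f i2 E) as (g2 & E2 & D2).
  destruct (open_near U x y HU Hp) as [eps L].
  split; [exists (g1 x y); now apply D1 | ].
  split; [exists (g2 x y); now apply D2 | split].
  - apply ex_diff_n_ext_loc with g1; [ | now apply IH].
    exists eps; intros u v Hu Hv; symmetry.
    exact (partial_unique i1 f u v _ (D1 u v (L u v Hu Hv))).
  - apply ex_diff_n_ext_loc with g2; [ | now apply IH].
    exists eps; intros u v Hu Hv; symmetry.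
    exact (partial_unique i2 f u v _ (D2 u v (L u v Hu Hv))).
Qed.

(** * Curvature of Type B connections *)

(** With [s = 1] this is [x^2] times the component of [d_l] in [R(d_1, d_2) d_k]
    for the Christoffel symbols [C/x]; with [s = 0] it is the same component for
    the constant Christoffel symbols [C]. *)
Definition riem (s : R) (C : typeB_coef) (k l : idx) : R :=
  sumI (fun m => C i2 k m * C i1 m l - C i1 k m * C i2 m l) - s * C i2 k l.

(** Since [R(d_1, d_2) d_k = rho_2k d_1 - rho_1k d_2] in dimension two. *)
Definition ricci (s : R) (C : typeB_coef) (i k : idx) : R :=
  match i with i1 => - riem s C k i2 | i2 => riem s C k i1 end.

(** For [s = 1]: [x^3] times
    [(nabla_1 rho)(d_2, d_j) - (nabla_2 rho)(d_1, d_j)]. *)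
Definition codazzi (s : R) (C : typeB_coef) (j : idx) : R :=
  - 2 * s * ricci s C i2 j
  - sumI (fun l => C i1 j l * ricci s C i2 l)
  + sumI (fun l => C i2 j l * ricci s C i1 l).

Definition symmetric (C : typeB_coef) : Prop := forall i j k, C i j k = C j i k.

Lemma half_plane_open : open half_plane.
Proof.
  apply (open_comp (fun p : R * R => fst p) (fun t => 0 < t)).
  - intros [u v] _; apply continuous_fst.
  - apply open_gt.
Qed.

Lemma half_plane_point : half_plane (1, 0).
Proof. unfold half_plane; simpl; lra. Qed.

Lemma curvature_typeB C k l x y :
  x <> 0 -> curvature (typeB_christoffel C) i1 i2 k l x y = / x ^ 2 * riem 1 C k l.
Proof.
  intros Hx; unfold curvature.
  rewrite (partial_unique i1 (typeB_christoffel C i2 k l) x y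
             (- / x ^ 2 * C i2 k l)).
  - rewrite (partial_unique i2 (typeB_christoffel C i1 k l) x y 0).
    + unfold riem, sumI, typeB_christoffel; field; easy.
    + apply (is_derive_const (/ x * C i1 k l)).
  - unfold is_partial, typeB_christoffel; auto_derive; [easy | field; easy].
Qed.

Lemma curvature_skew G i j k l x y :
  curvature G j i k l x y = - curvature G i j k l x y.
Proof. unfold curvature; ring. Qed.

Lemma flat_12 U G :
  (forall k l x y, U (x, y) -> curvature G i1 i2 k l x y = 0) -> flat_on U G.
Proof.
  intros H [] [] k l x y Hp.
  - unfold curvature; ring.
  - now apply H.
  - rewrite curvature_skew, H; trivial; ring.
  - unfold curvature; ring.
Qed.

Lemma flat_typeB C :
  flat_on half_plane (typeB_christoffel C) <-> forall k l, riem 1 C k l = 0.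
Proof.
  split.
  - intros H k l; specialize (H i1 i2 k l 1 0 half_plane_point).
    rewrite curvature_typeB in H by lra.
    rewrite <- H; field.
  - intros H; apply flat_12; intros k l x y Hp.
    unfold half_plane in Hp; simpl in Hp.
    rewrite curvature_typeB, H by lra; ring.
Qed.

Lemma riem_0 s C :
  riem s C i1 i1 = 0 -> riem s C i1 i2 = 0 ->
  riem s C i2 i1 = 0 -> riem s C i2 i2 = 0 -> forall k l, riem s C k l = 0.
Proof. now intros ? ? ? ? [] []. Qed.

(** The quadratic terms contribute the trace of a commutator, which is zero. In terms of [ricci]
    this is symmetry. *)
Lemma typeA_trace C : symmetric C -> riem 0 C i1 i1 = - riem 0 C i2 i2.
Proof.
  intros S; unfold riem, sumI; rewrite (S i2 i1 i1), (S i2 i1 i2); ring.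
Qed.

Lemma typeA_codazzi C j : symmetric C -> codazzi 0 C j = 0.
Proof.
  intros S; destruct j; unfold codazzi, ricci, riem, sumI;
    rewrite (S i2 i1 i1), (S i2 i1 i2); ring.
Qed.

(** The shift [t] is the one which makes [C_12^1] vanish in the coordinates
    [(x^1, t x^1 + x^2)]; the listed equations say that the coefficients there
    are those of [family2], up to the value of [C_22^1]. *)
Lemma codazzi_classification C :
  symmetric C -> (exists k l, riem 1 C k l <> 0) ->
  riem 1 C i1 i1 = - riem 1 C i2 i2 -> (forall j, codazzi 1 C j = 0) ->
  family1 C \/
  exists t v, C i2 i2 i1 <> 0 /\ v <> 0 /\
    C i1 i2 i1 = t * C i2 i2 i1 /\ C i2 i2 i2 = - t * C i2 i2 i1 /\
    C i1 i2 i2 = v - t ^ 2 * C i2 i2 i1 /\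
    C i1 i1 i1 = 1 + 2 * v + t ^ 2 * C i2 i2 i1 /\
    C i1 i1 i2 = 2 * t * v - t * C i1 i1 i1.
Proof.
  intros S NF Tr Cod.
  generalize (Cod i1) (Cod i2); clear Cod; revert NF Tr.
  unfold codazzi, ricci, riem, sumI, family1.
  intros NF; assert (NF0 : ~ forall k l, riem 1 C k l = 0).
  { intros H; destruct NF as (k & l & n); exact (n (H k l)). }
  clear NF; revert NF0.
  pose proof (S i2 i1 i1) as E1; pose proof (S i2 i1 i2) as E2.
  rewrite E1, E2; intros NF Tr H1 H2.
  (* Commutator traces cancel, leaving only the linear terms of [Tr]. *)
  assert (F : C i2 i2 i2 = - C i1 i2 i1) by lra.
  destruct (Req_dec (C i2 i2 i1) 0) as [Z | NZ]; [left | right].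
  - rewrite F, Z in H2.
    (* Here the cubic terms cancel and [H2] becomes a nonzero multiple of this square. *)
    assert (Z' : C i1 i2 i1 * C i1 i2 i1 = 0) by lra.
    assert (Z'' : C i1 i2 i1 = 0) by (destruct (Rmult_integral _ _ Z'); easy).
    repeat split; lra.
  - set (t := C i1 i2 i1 / C i2 i2 i1).
    assert (Ht : C i1 i2 i1 = t * C i2 i2 i1) by (unfold t; field; easy).
    clearbody t.
    exists t, (C i1 i2 i2 + t ^ 2 * C i2 i2 i1).
    rewrite F, Ht in H1, H2.
    (* [H2] is [-2 * C i2 i2 i1] times this expression. *)
    assert (HA : C i1 i1 i1 - 1 - 2 * C i1 i2 i2 - 3 * t ^ 2 * C i2 i2 i1 = 0).
    { apply Rmult_eq_reg_l with (-2 * C i2 i2 i1);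
        [rewrite Rmult_0_r; rewrite <- H2; ring | lra]. }
    (* [H1] minus [t] times [H2] is [3 * C i2 i2 i1] times this expression. *)
    assert (HB : C i1 i1 i2 + t * C i1 i1 i1
                 - 2 * t * (C i1 i2 i2 + t ^ 2 * C i2 i2 i1) = 0).
    { apply Rmult_eq_reg_l with (3 * C i2 i2 i1); [ | lra].
      rewrite Rmult_0_r.
      transitivity (0 - t * 0); [ | ring].
      rewrite <- H1 at 1; rewrite <- H2; ring. }
    split; [easy | split].
    (* With [v = 0] these relations would make the curvature vanish. *)
    + intros V; apply NF.
      assert (D : C i1 i2 i2 = - t ^ 2 * C i2 i2 i1) by lra.
      assert (A : C i1 i1 i1 = 1 + t ^ 2 * C i2 i2 i1) by lra.
      assert (B : C i1 i1 i2 = - t * C i1 i1 i1) by (rewrite V in HB; lra).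
      apply riem_0; unfold riem, sumI; rewrite ?E1, ?E2, ?F, ?Ht, ?B, ?A, ?D; ring.
    + repeat split; lra.
Qed.

(** * Linear changes of coordinates *)

Lemma linear_map_partial a b i c x y :
  partial i (linear_map a b c) x y =
  match c, i with i1, i1 => 1 | i1, i2 => 0 | i2, i1 => a | i2, i2 => b end.
Proof.
  apply partial_unique; destruct c, i; unfold linear_map; simpl;
    auto_derive; trivial; ring.
Qed.

Lemma linear_map_partial2 a b i j c x y :
  partial i (partial j (linear_map a b c)) x y = 0.
Proof.
  apply partial_unique.
  apply (is_partial_ext i (fun _ => True)
           (fun _ _ => match c, j with
              i1, i1 => 1 | i1, i2 => 0 | i2, i1 => a | i2, i2 => b end)).
  - apply open_true.
  - easy.
  - intros u v _; now rewrite linear_map_partial.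
  - apply is_partial_const.
Qed.

(** The map has no second derivatives and keeps [x^1], so the common factor [/ x] cancels and the
    tensor law for the constants remains. *)
Lemma linear_intertwines C C' a b :
  intertwines half_plane (typeB_christoffel C) (typeB_christoffel C')
    (linear_map a b) <->
  forall i j c,
    let J i c := match c, i with
      i1, i1 => 1 | i1, i2 => 0 | i2, i1 => a | i2, i2 => b end in
    sumI (fun k => C i j k * J k c) =
    sumI (fun p => sumI (fun q => C' p q c * J i p * J j q)).
Proof.
  split.
  - intros H i j c J; specialize (H i j c 1 0 half_plane_point).
    unfold sumI in *.
    rewrite linear_map_partial2, !linear_map_partial in H.
    unfold typeB_christoffel, J in *; simpl in H.
    rewrite Rinv_1 in H; lra.
  - intros H i j c x y Hp; specialize (H i j c); simpl in H.
    unfold sumI in *.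
    rewrite linear_map_partial2, !linear_map_partial.
    unfold typeB_christoffel, half_plane in *; simpl in *.
    transitivity (/ x * (C i j i1 * match c with i1 => 1 | i2 => a end +
      C i j i2 * match c with i1 => 0 | i2 => b end)); [ring | ].
    rewrite H; ring.
Qed.

(** The conditions say that [d_2] spans a parallel line field and that [nabla_{d_2} d_2 = 0]; the
    linear maps send [d_2] to a constant multiple of itself. *)
Lemma linear_equiv_family1 C C' :
  linearly_equiv C C' -> family1 C' -> family1 C.
Proof.
  intros (a & b & Hb & H) (F1 & F2 & F3); rewrite linear_intertwines in H.
  pose proof (H i1 i2 i1) as H1; pose proof (H i2 i2 i1) as H2;
    pose proof (H i2 i2 i2) as H3; simpl in *; unfold sumI in *.
  rewrite F1, F2, F3 in *.
  assert (Z2 : C i2 i2 i1 = 0) by lra.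
  assert (Z1 : C i1 i2 i1 = 0) by lra.
  repeat split; trivial.
  rewrite Z2 in H3; apply Rmult_eq_reg_r with b; lra.
Qed.

Lemma linearly_equiv_refl C : linearly_equiv C C.
Proof.
  exists 0, 1; split; [lra | ].
  apply linear_intertwines; intros i j []; unfold sumI; destruct i, j; ring.
Qed.

(** * The normal forms *)

Definition family2_coef (v e : R) : typeB_coef := fun i j k =>
  match i, j, k with
  | i1, i1, i1 => 1 + 2 * v
  | i1, i2, i2 | i2, i1, i2 => v
  | i2, i2, i1 => e
  | _, _, _ => 0
  end.

Lemma family2_coef_typeB v e : v <> 0 -> e <> 0 -> is_typeB (family2_coef v e).
Proof.
  intros Hv He; split.
  - now intros [] [] [].
  (* The component [Q_22] equals [e * v]. *)
  - rewrite flat_typeB; intros H; specialize (H i2 i1).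
    unfold riem, sumI, family2_coef in H.
    apply (Rmult_integral_contrapositive_currified e v He Hv); lra.
Qed.

Lemma typeB_not_riem_0 C : is_typeB C -> exists k l, riem 1 C k l <> 0.
Proof.
  intros [_ NF]; rewrite flat_typeB in NF.
  destruct (Req_dec (riem 1 C i1 i1) 0); [ | now exists i1, i1].
  destruct (Req_dec (riem 1 C i1 i2) 0); [ | now exists i1, i2].
  destruct (Req_dec (riem 1 C i2 i1) 0); [ | now exists i2, i1].
  destruct (Req_dec (riem 1 C i2 i2) 0); [ | now exists i2, i2].
  destruct NF; now apply riem_0.
Qed.

Lemma codazzi_normal_form C :
  is_typeB C -> riem 1 C i1 i1 = - riem 1 C i2 i2 ->
  (forall j, codazzi 1 C j = 0) ->
  exists C', is_typeB C' /\ linearly_equiv C C' /\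
    (family1 C' \/ exists v, family2 v C').
Proof.
  intros TB Tr Cod; pose proof (proj1 TB : symmetric C) as S.
  destruct (codazzi_classification C S (typeB_not_riem_0 C TB) Tr Cod)
    as [F1 | (t & v & He & Hv & E1 & E2 & E3 & E4 & E5)].
  { exists C; split; [easy | split; [apply linearly_equiv_refl | now left]]. }
  (* Rescaling [x^2] by [b] divides [C_22^1] by [b^2], so only its sign survives. *)
  assert (exists b e', b <> 0 /\ (e' = 1 \/ e' = -1) /\ C i2 i2 i1 = b * b * e')
    as (b & e' & Hb & He' & E).
  { destruct (Rlt_or_le 0 (C i2 i2 i1)) as [P | P].
    - exists (sqrt (C i2 i2 i1)), 1; split; [ | split; [now left | ]].
      + now apply Rgt_not_eq, sqrt_lt_R0.
      + rewrite sqrt_sqrt; lra.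
    - exists (sqrt (- C i2 i2 i1)), (-1); split; [ | split; [now right | ]].
      + apply Rgt_not_eq, sqrt_lt_R0; lra.
      + rewrite sqrt_sqrt; lra. }
  exists (family2_coef v e'); split; [ | split].
  - apply family2_coef_typeB; lra.
  (* The shift by [t], followed by the scaling by [b]. *)
  - exists (t * b), b; split; [easy | apply linear_intertwines].
    intros i j c; unfold sumI, family2_coef.
    destruct i, j, c; rewrite ?(S i2 i1), ?E5, ?E4, ?E3, ?E2, ?E1, ?E; ring.
  - right; exists v; repeat split; trivial.
Qed.

(** The coefficients of the connection [nabla - omega (x) id - id (x) omega] for
    [omega = (w / x^1) dx^1]. *)
Definition shift (C : typeB_coef) (w : R) : typeB_coef := fun i j k =>
  C i j k - w * (kron i i1 * kron j k + kron j i1 * kron i k).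

Lemma typeB_christoffel_smooth C i j k :
  smooth_on half_plane (typeB_christoffel C i j k).
Proof.
  apply elementary_smooth; [apply half_plane_open | ].
  apply (el_mult _ (fun x _ => / x) (fun _ _ => C i j k)).
  - now constructor.
  - constructor.
Qed.

(** The form [(w / x^1) dx^1] is closed and defined on the whole half-plane, so one flat connection
    serves every point and flatness becomes algebraic. *)
Lemma flat_shift_strongly_proj_flat C w :
  symmetric C -> (forall k l, riem 1 (shift C w) k l = 0) ->
  strongly_proj_flat half_plane (typeB_christoffel C).
Proof.
  intros S H p Hp.
  exists half_plane, (typeB_christoffel (shift C w)).
  split; [apply half_plane_open | split; [easy | split; [easy | ]]].
  split; [split | split].
  - intros; apply typeB_christoffel_smooth.
  - intros i j k x y _; unfold typeB_christoffel, shift.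
    rewrite (S i j k); ring.
  - now apply flat_typeB.
  - exists (fun i x _ => / x * (w * kron i i1)); split; [ | split].
    + intros i; apply (typeB_christoffel_smooth (fun _ _ _ => w * kron i i1) i i i).
    + assert (Z : forall x y, partial i2 (fun x _ => / x * (w * kron i1 i1)) x y
                            = partial i1 (fun x _ => / x * (w * kron i2 i1)) x y).
      { intros x y; transitivity 0; [ | symmetry]; apply partial_unique.
        - apply (is_derive_const (/ x * (w * kron i1 i1))).
        - apply (is_partial_ext i1 (fun _ => True) (fun _ _ => 0)); trivial.
          + apply open_true.
          + intros; unfold kron; simpl; ring.
          + apply is_partial_const. }
      intros [] [] x y _; trivial; now rewrite Z.
    + intros X Y _ _ k x y _.
      unfold cov_deriv, pairing, sumI, typeB_christoffel, shift.
      destruct k; unfold kron; simpl; ring.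
Qed.

Lemma family1_strongly_proj_flat C :
  symmetric C -> family1 C -> strongly_proj_flat half_plane (typeB_christoffel C).
Proof.
  intros S (F1 & F2 & F3); apply (flat_shift_strongly_proj_flat C (C i1 i2 i2) S).
  apply riem_0; unfold riem, sumI, shift, kron; simpl;
    rewrite ?(S i2 i1), ?F1, ?F2, ?F3; ring.
Qed.

(** Linear maps fix [dx^1], so the form that flattens the normal form also flattens [C]. Instead of
    transporting flatness, the tensor law is solved for [C] and the shifted curvature computed. *)
Lemma family2_strongly_proj_flat C C' v :
  symmetric C -> symmetric C' -> linearly_equiv C C' -> family2 v C' ->
  strongly_proj_flat half_plane (typeB_christoffel C).
Proof.
  intros S S' (a & b & Hb & H) (F1 & F2 & F3 & F4 & _ & F6).
  apply (flat_shift_strongly_proj_flat C v S).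
  rewrite linear_intertwines in H.
  assert (E1 : forall i j, C i j i1 =
    match i, j with i1, i1 => 1 + 2 * v + a ^ 2 * C' i2 i2 i1
      | i2, i2 => b ^ 2 * C' i2 i2 i1 | _, _ => a * b * C' i2 i2 i1 end).
  { intros i j; specialize (H i j i1); simpl in H; unfold sumI in H.
    rewrite (S' i2 i1), F1, F3 in H.
    destruct i, j; lra. }
  assert (E2 : forall i j, b * C i j i2 = - a * C i j i1 +
    match i, j with i1, i1 => 2 * a * v | i2, i2 => 0 | _, _ => b * v end).
  { intros i j; specialize (H i j i2); simpl in H; unfold sumI in H.
    rewrite (S' i2 i1), F2, F4, F6 in H.
    destruct i, j; lra. }
  assert (E3 : forall i j, C i j i2 = / b * (- a * C i j i1 +
    match i, j with i1, i1 => 2 * a * v | i2, i2 => 0 | _, _ => b * v end)).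
  { intros i j; rewrite <- E2; field; easy. }
  apply riem_0; unfold riem, sumI, shift, kron; simpl;
    rewrite !E3, !E1; field; easy.
Qed.

(** * Strong projective flatness *)

Lemma strongly_proj_equiv_christoffel (U : R * R -> Prop) G G' :
  open U -> strongly_proj_equiv U G G' ->
  exists w : Defs.form1, (forall i, smooth_on U (w i)) /\ closed_form U w /\
    forall i j k x y, U (x, y) ->
      G' i j k x y = G i j k x y - w i x y * kron j k - w j x y * kron i k.
Proof.
  intros HU (w & Sw & Cw & H); exists w; split; [easy | split; [easy | ]].
  intros i j k x y Hp.
  assert (SC : forall m n, smooth_on U (fun _ _ => kron m n)).
  { intros; apply elementary_smooth; [easy | constructor]. }
  (* Constant coordinate fields remove the derivative terms and isolate single Christoffel
     symbols. *)
  specialize (H (fun m _ _ => kron i m) (fun m _ _ => kron j m)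
                (SC i) (SC j) k x y Hp).
  unfold cov_deriv, pairing, sumI in H.
  rewrite !(fun m => partial_unique m _ x y 0 (is_partial_const m (kron j k) x y))
    in H.
  destruct i, j; unfold kron in *; simpl in *; destruct k; simpl in *; lra.
Qed.

(** The curvature of [G] is affine in the derivatives of [w], and its vanishing, with [dw = 0],
    determines them all. Its trace contains them only through [dw], whence the symmetry of the Ricci
    tensor. *)
Lemma strongly_proj_flat_system C (U : R * R -> Prop) (G : christoffel) :
  symmetric C -> open U -> (forall q, U q -> half_plane q) ->
  flat_on U G -> strongly_proj_equiv U (typeB_christoffel C) G ->
  ((exists p, U p) -> riem 1 C i1 i1 = - riem 1 C i2 i2) /\
  exists w : Defs.form1, (forall i, smooth_on U (w i)) /\
    forall i j x y, U (x, y) -> partial i (w j) x y =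
      / x * (C i j i1 * w i1 x y + C i j i2 * w i2 x y) - w i x y * w j x y
      - / x * / x * ricci 1 C i j.
Proof.
  intros S HU Sub Fl Eq.
  destruct (strongly_proj_equiv_christoffel _ _ _ HU Eq) as (w & Sw & Cw & E).
  assert (D : forall m i j k x y, U (x, y) -> partial m (G i j k) x y =
    - kron m i1 * (/ x * / x) * C i j k
    - partial m (w i) x y * kron j k - partial m (w j) x y * kron i k).
  { intros m i j k x y Hp.
    assert (Hx : x <> 0) by (apply Sub in Hp; unfold half_plane in Hp; simpl in Hp; lra).
    pose proof (fun i => smooth_is_partial m U (w i) x y (Sw i) Hp) as Dw.
    apply partial_unique, (is_partial_ext m U (fun x y =>
      / x * C i j k - w i x y * kron j k - w j x y * kron i k)); trivial.
    - intros u v Hu; symmetry; now apply E.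
    - eapply is_partial_eq; [split_partial; [exact Hx | apply Dw | apply Dw] | ].
      simpl; ring. }
  assert (R12 : forall k l x y, U (x, y) ->
    let W i j := partial i (w j) x y in
    - (/ x * / x) * C i2 k l - (W i1 i2 - W i2 i1) * kron k l
    - W i1 k * kron i2 l + W i2 k * kron i1 l
    + sumI (fun m => (/ x * C i2 k m - w i2 x y * kron k m - w k x y * kron i2 m)
                   * (/ x * C i1 m l - w i1 x y * kron m l - w m x y * kron i1 l))
    - sumI (fun m => (/ x * C i1 k m - w i1 x y * kron k m - w k x y * kron i1 m)
                   * (/ x * C i2 m l - w i2 x y * kron m l - w m x y * kron i2 l))
    = 0).
  { intros k l x y Hp W; specialize (Fl i1 i2 k l x y Hp); unfold curvature in Fl.
    rewrite !D in Fl by easy; unfold sumI in *; rewrite !E in Fl by easy.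
    unfold typeB_christoffel in Fl; unfold W.
    rewrite <- Fl; unfold kron; simpl; ring. }
  clear Fl D E Eq.
  split.
  - intros [[x y] Hp].
    pose proof (R12 i1 i1 x y Hp) as H11; pose proof (R12 i2 i2 x y Hp) as H22.
    apply Sub in Hp as Hx; unfold half_plane in Hx; simpl in Hx.
    pose proof (Cw i2 i1 x y Hp) as Sym.
    apply Rmult_eq_reg_l with (/ x * / x);
      [ | apply Rgt_not_eq, Rmult_lt_0_compat; now apply Rinv_0_lt_compat].
    unfold riem, sumI, kron in *; simpl in *.
    rewrite !(S i2 i1) in *; lra.
  - exists w; split; [easy | ].
    intros i j x y Hp.
    pose proof (R12 i1 i1 x y Hp) as H11; pose proof (R12 i1 i2 x y Hp) as H12;
    pose proof (R12 i2 i1 x y Hp) as H21; pose proof (R12 i2 i2 x y Hp) as H22.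
    pose proof (Cw i2 i1 x y Hp) as Sym.
    destruct i, j; unfold ricci, riem, sumI, kron in *; simpl in *;
      rewrite ?(S i2 i1) in *; lra.
Qed.

(** Equating the mixed derivatives of [w j] and substituting the system twice cancels [w] and leaves
    the Codazzi equation. As that involves only constants, the point [(1, 0)], where [/ x = 1],
    suffices. *)
Lemma strongly_proj_flat_codazzi C :
  symmetric C -> strongly_proj_flat half_plane (typeB_christoffel C) ->
  riem 1 C i1 i1 = - riem 1 C i2 i2 /\ forall j, codazzi 1 C j = 0.
Proof.
  intros S H; destruct (H (1, 0) half_plane_point)
    as (U & G & HU & Hp & Sub & _ & Fl & Eq).
  destruct (strongly_proj_flat_system C U G S HU Sub Fl Eq) as (Tr & w & Sw & D).
  specialize (Tr (ex_intro _ _ Hp)); split; [easy | ].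
  assert (DD : forall m i j, partial m (partial i (w j)) 1 0 =
    - kron m i1 * (C i j i1 * w i1 1 0 + C i j i2 * w i2 1 0)
    + (C i j i1 * partial m (w i1) 1 0 + C i j i2 * partial m (w i2) 1 0)
    - partial m (w i) 1 0 * w j 1 0 - w i 1 0 * partial m (w j) 1 0
    + 2 * kron m i1 * ricci 1 C i j).
  { intros m i j.
    pose proof (fun i => smooth_is_partial m U (w i) 1 0 (Sw i) Hp) as Dw.
    apply partial_unique, (is_partial_ext m U (fun x y =>
      / x * (C i j i1 * w i1 x y + C i j i2 * w i2 x y) - w i x y * w j x y
      - / x * / x * ricci 1 C i j)); trivial.
    - intros u v Hu; symmetry; now apply D.
    - eapply is_partial_eq; [split_partial; first [lra | apply Dw] | ].
      rewrite Rinv_1; ring. }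
  intros j; pose proof (partial_comm i1 i2 U (w j) 1 0 HU (Sw j) Hp) as SC.
  rewrite !DD, !D, !Rinv_1 in SC by easy.
  unfold codazzi; revert SC Tr; destruct j; unfold ricci, riem, sumI, kron; simpl;
    rewrite ?(S i2 i1); intros SC Tr.
  all: assert (F : C i2 i2 i2 = - C i1 i2 i1) by lra; rewrite F in *; lra.
Qed.

(** * Flat pullback metrics *)

Definition jac (phi : idx -> Defs.scal) (x y : R) (i c : idx) : R :=
  partial i (phi c) x y.

Definition det (J : idx -> idx -> R) : R := J i1 i1 * J i2 i2 - J i1 i2 * J i2 i1.

Definition bil (B : idx -> idx -> R) (u v : idx -> R) : R :=
  sumI (fun a => sumI (fun b => B a b * u a * v b)).

Lemma cramer (J : idx -> idx -> R) (u : idx -> R) : det J <> 0 ->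
  exists a b, forall c, u c = a * J i1 c + b * J i2 c.
Proof.
  intros H; unfold det in H.
  exists ((u i1 * J i2 i2 - u i2 * J i2 i1) / det J),
         ((J i1 i1 * u i2 - J i1 i2 * u i1) / det J).
  intros []; unfold det; field; exact H.
Qed.

(** The chain rule for [psi] after [phi] gives the Jacobian matrix an inverse. *)
Lemma diffeo_det U V phi x y :
  open U -> open V -> diffeo U V phi -> U (x, y) -> det (jac phi x y) <> 0.
Proof.
  intros HU HV (Sphi & MUV & psi & Spsi & _ & Inv & _) Hp.
  assert (CR : forall a i,
    partial i1 (psi a) (phi i1 x y) (phi i2 x y) * jac phi x y i i1
    + partial i2 (psi a) (phi i1 x y) (phi i2 x y) * jac phi x y i i2 = kron a i).
  { intros a i.
    pose proof (smooth_differentiable V (psi a) _ _ HV (Spsi a) (MUV x y Hp)) as Dpsi.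
    pose proof (fun c => smooth_is_partial i U (phi c) x y (Sphi c) Hp) as Dphi.
    assert (E : partial i (fun x y => psi a (phi i1 x y) (phi i2 x y)) x y = kron a i).
    { apply partial_unique, (is_partial_ext i U
        (match a with i1 => fun x _ => x | i2 => fun _ y => y end)); trivial.
      - intros u v Huv; destruct (Inv u v Huv); now destruct a.
      - destruct a, i; simpl.
        + apply (is_derive_id x).
        + apply (is_derive_const x).
        + apply (is_derive_const y).
        + apply (is_derive_id y). }
    rewrite <- E; symmetry; apply partial_unique.
    unfold jac; destruct i; apply is_derive_Reals.
    - apply (derivable_pt_lim_comp_2d (psi a) (fun t => phi i1 t y) (fun t => phi i2 t y));
        [exact Dpsi | apply is_derive_Reals, Dphi | apply is_derive_Reals, Dphi].
    - apply (derivable_pt_lim_comp_2d (psi a) (fun t => phi i1 x t) (fun t => phi i2 x t));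
        [exact Dpsi | apply is_derive_Reals, Dphi | apply is_derive_Reals, Dphi]. }
  intros Z; unfold det in Z.
  pose proof (CR i1 i1 : _ = 1) as E11; pose proof (CR i1 i2 : _ = 0) as E12;
  pose proof (CR i2 i1 : _ = 0) as E21; pose proof (CR i2 i2 : _ = 1) as E22.
  revert E11 E12 E21 E22 Z; generalize (jac phi x y).
  generalize (partial i1 (psi i1) (phi i1 x y) (phi i2 x y)) as a.
  generalize (partial i2 (psi i1) (phi i1 x y) (phi i2 x y)) as b.
  generalize (partial i1 (psi i2) (phi i1 x y) (phi i2 x y)) as c.
  generalize (partial i2 (psi i2) (phi i1 x y) (phi i2 x y)) as d.
  intros d c b a J E11 E12 E21 E22 Z.
  assert (H : (a * d - b * c) * (J i1 i1 * J i2 i2 - J i1 i2 * J i2 i1)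
    = (a * J i1 i1 + b * J i1 i2) * (c * J i2 i1 + d * J i2 i2)
    - (a * J i2 i1 + b * J i2 i2) * (c * J i1 i1 + d * J i1 i2)) by ring.
  rewrite Z, E11, E12, E21, E22 in H; lra.
Qed.

(** Here [p], [m], [q] stand for [Q_11], [Q_12], [Q_22], the other unknowns for coefficients of
    second derivatives of a chart in the basis of first ones. With [D = p q - m^2], the four metric
    equations give [(a + b') D = -2 D] and [a + b' = -3] gives [-3 D]; so [D = 0]. *)
Lemma conformal_degenerate p m q a b a' b' :
  q <> 0 -> a + b' = -3 -> a * p + b * m = - p -> a * m + b * q = -2 * m ->
  a' * p + b' * m = 0 -> a' * m + b' * q = - q -> p = 0 /\ m = 0.
Proof.
  intros Hq s k1 k2 k3 k4.
  assert (e1 : a * (p * q - m * m) = 2 * (m * m) - p * q).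
  { transitivity ((a * p + b * m) * q - (a * m + b * q) * m); [ring | ].
    rewrite k1, k2; ring. }
  assert (e2 : b' * (p * q - m * m) = - (p * q)).
  { transitivity ((a' * m + b' * q) * p - (a' * p + b' * m) * m); [ring | ].
    rewrite k3, k4; ring. }
  assert (Z : p * q - m * m = 0).
  { assert (e3 : (a + b') * (p * q - m * m) = -2 * (p * q - m * m)) by lra.
    rewrite s in e3; lra. }
  rewrite Z in e2.
  assert (Zp : p = 0) by (apply Rmult_eq_reg_r with q; lra).
  split; [easy | ].
  rewrite Zp in Z; assert (Zm : m * m = 0) by lra.
  now destruct (Rmult_integral _ _ Zm).
Qed.

(** If [phi] pulls the constant form [B] back to [Q / x^2], the metric [Q / x^2]
    is flat. When [Q] is nondegenerate its Gauss curvature is a multiple of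
    [Q^11]; the argument below also covers degenerate [Q]. *)
Lemma flat_conformal_form (U : R * R -> Prop) phi (B Q : idx -> idx -> R) :
  open U -> U (1, 0) -> (forall q, U q -> half_plane q) ->
  (forall c, smooth_on U (phi c)) ->
  (forall x y, U (x, y) -> det (jac phi x y) <> 0) ->
  B i1 i2 = B i2 i1 -> Q i1 i2 = Q i2 i1 ->
  (forall i j x y, U (x, y) ->
     bil B (jac phi x y i) (jac phi x y j) = / x * / x * Q i j) ->
  Q i2 i2 = 0.
Proof.
  intros HU Hp Sub S ND SB SQ E.
  assert (Hx : forall x y, U (x, y) -> x <> 0).
  { intros x y H; apply Sub in H; unfold half_plane in H; simpl in H; lra. }
  pose (h i j x y c := partial i (partial j (phi c)) x y).
  assert (hC : forall i j x y c, U (x, y) -> h i j x y c = h j i x y c).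
  { intros; now apply (partial_comm i j U). }
  assert (D1 : forall i j c x y, U (x, y) ->
    is_partial i (fun x y => jac phi x y j c) x y (h i j x y c)).
  { intros i j c x y H.
    exact (smooth_is_partial i U _ x y (smooth_partial j _ _ (S c)) H). }
  assert (D2 : forall m i j c x y, U (x, y) ->
    is_partial m (fun x y => h i j x y c) x y (partial m (fun x y => h i j x y c) x y)).
  { intros m i j c x y H.
    exact (smooth_is_partial m U _ x y
             (smooth_partial i _ _ (smooth_partial j _ _ (S c))) H). }
  assert (Leib : forall m (u v : R -> R -> idx -> R) du dv x y,
    (forall c, is_partial m (fun x y => u x y c) x y (du c)) ->
    (forall c, is_partial m (fun x y => v x y c) x y (dv c)) ->
    is_partial m (fun x y => bil B (u x y) (v x y)) x y
      (bil B du (v x y) + bil B (u x y) dv)).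
  { intros m u v du dv x y Hu Hv; unfold bil, sumI.
    eapply is_partial_eq; [split_partial;
      [apply Hu | apply Hv | apply Hu | apply Hv
      | apply Hu | apply Hv | apply Hu | apply Hv] | ].
    simpl; ring. }
  (* The differentiated pullback identity, from which [K12], [K12'] and [K22] isolate single
     products as in Koszul's formula. *)
  assert (K : forall m i j x y, U (x, y) ->
    bil B (h m i x y) (jac phi x y j) + bil B (jac phi x y i) (h m j x y)
    = -2 * kron m i1 * (/ x * / x * / x) * Q i j).
  { intros m i j x y H.
    rewrite <- (partial_unique m _ x y _
      (Leib m (fun x y => jac phi x y i) (fun x y => jac phi x y j) _ _ x y
        (fun c => D1 m i c x y H) (fun c => D1 m j c x y H))).
    apply partial_unique, (is_partial_ext m U (fun x y => / x * / x * Q i j)); trivial.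
    - intros u v Huv; symmetry; now apply E.
    - eapply is_partial_eq; [split_partial; now apply (Hx x y) | ].
      simpl; ring. }
  assert (BC : forall u v, bil B u v = bil B v u).
  { intros u v; unfold bil, sumI; rewrite SB; ring. }
  assert (bilE : forall u u' v, (forall c, u c = u' c) -> bil B u v = bil B u' v).
  { intros u u' v H; unfold bil, sumI; now rewrite !H. }
  assert (K12 : forall x y, U (x, y) -> bil B (h i1 i2 x y) (jac phi x y i1) = 0).
  { intros x y H; pose proof (K i2 i1 i1 x y H) as k.
    rewrite (BC (jac phi x y i1)) in k.
    rewrite (bilE _ (h i2 i1 x y)) by (intros c; now apply hC).
    unfold kron in k; simpl in k; lra. }
  assert (K12' : forall x y, U (x, y) ->
    bil B (h i1 i2 x y) (jac phi x y i2) = - (/ x * / x * / x) * Q i2 i2).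
  { intros x y H; pose proof (K i1 i2 i2 x y H) as k.
    rewrite (BC (jac phi x y i2)) in k.
    unfold kron in k; simpl in k; lra. }
  assert (K22 : forall x y, U (x, y) ->
    bil B (h i2 i2 x y) (jac phi x y i1) = / x * / x * / x * Q i2 i2).
  { intros x y H; pose proof (K i2 i2 i1 x y H) as k.
    rewrite (BC (jac phi x y i2)) in k.
    rewrite (bilE (h i2 i1 x y) (h i1 i2 x y)), K12' in k by (trivial; intros c; now apply hC).
    unfold kron in k; simpl in k; lra. }
  (* Subtracting the [x^2]-derivative of [K12] from the [x^1]-derivative of [K22] cancels the third
     derivatives of [phi]: the Gauss equation of a flat form. *)
  assert (Gauss : bil B (h i2 i2 1 0) (h i1 i1 1 0) - bil B (h i1 i2 1 0) (h i1 i2 1 0)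
                  = -3 * Q i2 i2).
  { pose proof (partial_unique i1 _ 1 0 _
      (Leib i1 (h i2 i2) (fun x y => jac phi x y i1) _ _ 1 0
        (fun c => D2 i1 i2 i2 c 1 0 Hp) (fun c => D1 i1 i1 c 1 0 Hp))) as G1.
    pose proof (partial_unique i2 _ 1 0 _
      (Leib i2 (h i1 i2) (fun x y => jac phi x y i1) _ _ 1 0
        (fun c => D2 i2 i1 i2 c 1 0 Hp) (fun c => D1 i2 i1 c 1 0 Hp))) as G2.
    rewrite (partial_unique i1 _ 1 0 (-3 * Q i2 i2)) in G1.
    2: { apply (is_partial_ext i1 U (fun x y => / x * / x * / x * Q i2 i2)); trivial.
         - intros u v Huv; symmetry; now apply K22.
         - eapply is_partial_eq; [split_partial; lra | ].
           unfold kron; simpl; rewrite Rinv_1; ring. }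
    rewrite (partial_unique i2 _ 1 0 0) in G2.
    2: { apply (is_partial_ext i2 U (fun x y => 0)); trivial.
         - intros u v Huv; symmetry; now apply K12.
         - apply is_partial_const. }
    rewrite (bilE (fun c => partial i1 (fun x y => h i2 i2 x y c) 1 0)
                  (fun c => partial i2 (fun x y => h i1 i2 x y c) 1 0)) in G1.
    2: { intros c; apply (partial_comm i1 i2 U (partial i2 (phi c))); trivial.
         apply smooth_partial, S. }
    rewrite (BC (h i1 i2 1 0) (h i2 i1 1 0)) in G2.
    rewrite (bilE (h i2 i1 1 0) (h i1 i2 1 0)) in G2
      by (intros c; now apply hC).
    lra. }
  destruct (Req_dec (Q i2 i2) 0) as [Z | NZ]; [easy | exfalso].
  pose proof (K i1 i1 i1 1 0 Hp) as k1; pose proof (K i1 i1 i2 1 0 Hp) as k2.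
  pose proof (K12 1 0 Hp) as k3; pose proof (K12' 1 0 Hp) as k4.
  pose proof (K22 1 0 Hp) as k5; pose proof (K i2 i2 i2 1 0 Hp) as k6.
  rewrite (BC (jac phi 1 0 i1)) in k1, k2; rewrite (BC (jac phi 1 0 i2)) in k6.
  (* Expanding in the basis of first derivatives avoids inverting [Q]. *)
  destruct (cramer (jac phi 1 0) (h i1 i1 1 0) (ND 1 0 Hp)) as (a & b & e1).
  destruct (cramer (jac phi 1 0) (h i1 i2 1 0) (ND 1 0 Hp)) as (a' & b' & e2).
  assert (Lin : forall u (a b : R) v,
    (forall c, u c = a * jac phi 1 0 i1 c + b * jac phi 1 0 i2 c) ->
    bil B u v = a * bil B (jac phi 1 0 i1) v + b * bil B (jac phi 1 0 i2) v).
  { intros u a0 b0 v H; unfold bil, sumI; rewrite !H; ring. }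
  pose proof (fun v => Lin _ a b v e1) as L1.
  pose proof (fun v => Lin _ a' b' v e2) as L2.
  rewrite (BC (h i2 i2 1 0)), L1, L2 in Gauss.
  rewrite (BC (jac phi 1 0 i1) (h i2 i2 1 0)), (BC (jac phi 1 0 i2) (h i2 i2 1 0)),
    (BC (jac phi 1 0 i1) (h i1 i2 1 0)), (BC (jac phi 1 0 i2) (h i1 i2 1 0)),
    k3, k4, k5 in Gauss.
  rewrite k3, L1 in k2; rewrite L1 in k1; rewrite L2 in k3, k4.
  rewrite !E in k1, k2, k3, k4 by easy.
  assert (k7 := K12' 1 0 Hp).
  revert NZ k1 k2 k3 k4 k6 k7 Gauss; rewrite !Rinv_1, <- SQ; unfold kron; cbn [idx_eqb].
  intros NZ k1 k2 k3 k4 k6 k7 Gauss.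
  assert (k8 : bil B (h i2 i2 1 0) (jac phi 1 0 i2) = 0) by lra.
  rewrite k8 in Gauss.
  assert (s : a + b' = -3) by (apply Rmult_eq_reg_r with (Q i2 i2); lra).
  destruct (conformal_degenerate (Q i1 i1) (Q i1 i2) (Q i2 i2) a b a' b')
    as [Z1 Z2]; try lra.
  (* Now [Q_11 = Q_12 = 0], so the image of [d_1] lies in the kernel of [B]. Differentiating along
     [x^2] puts [h i1 i2] there too, against [K12']. *)
  assert (Ker : forall c x y, U (x, y) ->
    B i1 c * jac phi x y i1 i1 + B i2 c * jac phi x y i1 i2 = 0).
  { intros c x y H.
    pose proof (E i1 i1 x y H) as g1; pose proof (E i1 i2 x y H) as g2.
    rewrite Z1, Rmult_0_r in g1; rewrite Z2, Rmult_0_r in g2.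
    unfold bil, sumI in g1, g2.
    apply Rmult_eq_reg_r with (det (jac phi x y)); [ | now apply ND].
    unfold det; destruct c; rewrite Rmult_0_l.
    - transitivity (0 * jac phi x y i2 i2 - 0 * jac phi x y i1 i2); [ | ring].
      rewrite <- g1 at 1; rewrite <- g2; ring.
    - transitivity (0 * jac phi x y i1 i1 - 0 * jac phi x y i2 i1); [ | ring].
      rewrite <- g2 at 1; rewrite <- g1; ring. }
  assert (KerD : forall c, B i1 c * h i1 i2 1 0 i1 + B i2 c * h i1 i2 1 0 i2 = 0).
  { intros c; rewrite !(hC i1 i2) by easy.
    transitivity (partial i2 (fun x y =>
      B i1 c * jac phi x y i1 i1 + B i2 c * jac phi x y i1 i2) 1 0).
    - symmetry; apply partial_unique.
      eapply is_partial_eq;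
        [split_partial; [apply (D1 i2 i1 i1 1 0 Hp) | apply (D1 i2 i1 i2 1 0 Hp)] | ].
      simpl; ring.
    - apply partial_unique, (is_partial_ext i2 U (fun x y => 0)); trivial.
      + intros u v Hu; symmetry; now apply Ker.
      + apply is_partial_const. }
  apply NZ; transitivity (- bil B (h i1 i2 1 0) (jac phi 1 0 i2)); [lra | ].
  transitivity (- ((B i1 i1 * h i1 i2 1 0 i1 + B i2 i1 * h i1 i2 1 0 i2) * jac phi 1 0 i2 i1
    + (B i1 i2 * h i1 i2 1 0 i1 + B i2 i2 * h i1 i2 1 0 i2) * jac phi 1 0 i2 i2)).
  - unfold bil, sumI; ring.
  - rewrite !KerD; ring.
Qed.

(** * Charts with constant Christoffel symbols *)

(** The Hessian of a chart with Jacobian [J] which turns the Christoffel symbols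
    [r C] into the constants [A]. *)
Definition hess (C A : typeB_coef) (r : R) (J : idx -> idx -> R) (i j c : idx) : R :=
  r * (C i j i1 * J i1 c + C i j i2 * J i2 c) - bil (fun a b => A a b c) (J i) (J j).

(** The antisymmetric part of [A] enters the Hessian multiplied by [det J], so commuting second
    derivatives kill it. *)
Lemma hess_antisym C A r J :
  symmetric C -> (forall c, hess C A r J i1 i2 c = hess C A r J i2 i1 c) ->
  det J <> 0 -> symmetric A.
Proof.
  intros S H D.
  assert (Z : forall c, A i1 i2 c = A i2 i1 c).
  { intros c; specialize (H c); unfold hess in H; rewrite !(S i2 i1) in H.
    apply Rmult_eq_reg_r with (det J); [ | easy].
    unfold bil, sumI in H; unfold det; lra. }
  intros [] [] k; now rewrite ?Z.
Qed.

(** Applying the adjugate of [J] to the transformation law of the curvature leaves a factor [det J]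
    on both sides. *)
Lemma riem_pullback (K L J : idx -> idx -> R) r : r <> 0 -> det J <> 0 ->
  (forall j c, r * r * (K j i1 * J i1 c + K j i2 * J i2 c)
             = det J * (L i1 c * J j i1 + L i2 c * J j i2)) ->
  forall j,
    r * r * K j i1 = (L i1 i1 * J j i1 + L i2 i1 * J j i2) * J i2 i2
                     - (L i1 i2 * J j i1 + L i2 i2 * J j i2) * J i2 i1 /\
    r * r * K j i2 = (L i1 i2 * J j i1 + L i2 i2 * J j i2) * J i1 i1
                     - (L i1 i1 * J j i1 + L i2 i1 * J j i2) * J i1 i2.
Proof.
  intros Hr HD H j; pose proof (H j i1) as e1; pose proof (H j i2) as e2.
  split; apply Rmult_eq_reg_l with (det J); trivial.
  - transitivity ((r * r * (K j i1 * J i1 i1 + K j i2 * J i2 i1)) * J i2 i2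
      - (r * r * (K j i1 * J i1 i2 + K j i2 * J i2 i2)) * J i2 i1);
      [unfold det; ring | rewrite e1, e2; ring].
  - transitivity ((r * r * (K j i1 * J i1 i2 + K j i2 * J i2 i2)) * J i1 i1
      - (r * r * (K j i1 * J i1 i1 + K j i2 * J i2 i1)) * J i1 i2);
      [unfold det; ring | rewrite e1, e2; ring].
Qed.

Section TypeA_chart.

Variables (U : R * R -> Prop) (C A : typeB_coef) (phi : idx -> Defs.scal).
Hypotheses (HU : open U) (Hp : U (1, 0)) (Sub : forall q, U q -> half_plane q).
Hypotheses (SC : symmetric C) (Sphi : forall c, smooth_on U (phi c)).
Hypothesis (ND : forall x y, U (x, y) -> det (jac phi x y) <> 0).
Hypothesis (I : intertwines U (typeB_christoffel C) (fun a b c _ _ => A a b c) phi).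

Lemma chart_x_neq0 x y : U (x, y) -> x <> 0.
Proof. intros H; apply Sub in H; unfold half_plane in H; simpl in H; lra. Qed.

Lemma chart_hessian i j c x y : U (x, y) ->
  partial i (fun x y => jac phi x y j c) x y = hess C A (/ x) (jac phi x y) i j c.
Proof.
  intros H; specialize (I i j c x y H).
  unfold hess, bil, sumI, jac, typeB_christoffel in *.
  change (fun x y => partial j (phi c) x y) with (partial j (phi c)); lra.
Qed.

Lemma chart_jac_partial i j c x y : U (x, y) ->
  is_partial i (fun x y => jac phi x y j c) x y (hess C A (/ x) (jac phi x y) i j c).
Proof.
  intros H; rewrite <- chart_hessian by easy.
  exact (smooth_is_partial i U _ x y (smooth_partial j _ _ (Sphi c)) H).
Qed.

Lemma chart_symmetric : symmetric A.
Proof.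
  apply (hess_antisym C A (/ 1) (jac phi 1 0) SC); [ | now apply ND].
  intros c; rewrite <- !chart_hessian by easy.
  now apply (partial_comm i1 i2 U).
Qed.

Lemma chart_hessian_partial m i j c x y : U (x, y) ->
  let J := jac phi x y in
  let h := hess C A (/ x) J in
  partial m (partial i (fun x y => jac phi x y j c)) x y =
  - kron m i1 * (/ x * / x) * (C i j i1 * J i1 c + C i j i2 * J i2 c)
  + / x * (C i j i1 * h m i1 c + C i j i2 * h m i2 c)
  - bil (fun a b => A a b c) (h m i) (J j) - bil (fun a b => A a b c) (J i) (h m j).
Proof.
  intros H J h; apply partial_unique.
  apply (is_partial_ext m U
    (fun x y => hess C A (/ x) (jac phi x y) i j c)); trivial.
  { intros u v Huv; symmetry; now apply chart_hessian. }
  unfold hess at 1, bil, sumI.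
  eapply is_partial_eq.
  - split_partial; first [exact (chart_x_neq0 x y H) | now apply chart_jac_partial].
  - fold J; unfold h, bil, sumI; ring.
Qed.

(** The integrability condition of the Hessian system: as third derivatives of the chart commute,
    [R(d_1, d_2) d_j] is carried to the curvature of [A]. *)
Lemma chart_riem j c x y : U (x, y) ->
  let J := jac phi x y in
  / x * / x * (riem 1 C j i1 * J i1 c + riem 1 C j i2 * J i2 c)
  = det J * (riem 0 A i1 c * J j i1 + riem 0 A i2 c * J j i2).
Proof.
  intros H J.
  pose proof (partial_comm i1 i2 U (partial j (phi c)) x y HU
                (smooth_partial j _ _ (Sphi c)) H) as E.
  pose proof (chart_hessian_partial i1 i2 j c x y H) as T1.
  pose proof (chart_hessian_partial i2 i1 j c x y H) as T2.
  change (partial j (phi c)) with (fun x y => jac phi x y j c) in E.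
  rewrite T1, T2 in E; fold J in E.
  generalize chart_symmetric; intros SA.
  revert E; generalize (/ x) J; clear - SC SA; intros r J E.
  (* As differences equal to zero, the goal and [E] are the same polynomial. *)
  apply Rminus_diag_uniq; apply Rminus_diag_eq in E.
  match type of E with ?e = _ => transitivity e; [ | exact E] end.
  unfold riem, hess, det, bil, sumI, kron; cbn [idx_eqb].
  destruct j, c; rewrite ?(SC i2 i1), ?(SA i2 i1); ring.
Qed.

Lemma chart_ricci :
  riem 1 C i1 i1 = - riem 1 C i2 i2 /\
  forall i j x y, U (x, y) ->
    bil (ricci 0 A) (jac phi x y i) (jac phi x y j) = / x * / x * ricci 1 C i j.
Proof.
  pose proof (typeA_trace A chart_symmetric) as TA.
  assert (P : forall x y, U (x, y) -> _) by (intros x y H; exact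
    (riem_pullback (riem 1 C) (riem 0 A) (jac phi x y) (/ x)
      (Rinv_neq_0_compat x (chart_x_neq0 x y H)) (ND x y H)
      (fun j c => chart_riem j c x y H))).
  split.
  - destruct (P 1 0 Hp i1) as [P11 _]; destruct (P 1 0 Hp i2) as [_ P22].
    rewrite Rinv_1, !Rmult_1_l in P11, P22; rewrite P11, P22, TA; ring.
  - intros i j x y H; destruct (P x y H j) as [P1 P2].
    destruct i; unfold ricci at 2.
    + rewrite Ropp_mult_distr_r_reverse, P2.
      unfold bil, sumI, ricci; rewrite TA; ring.
    + rewrite P1; unfold bil, sumI, ricci; rewrite TA; ring.
Qed.

(** Differentiating the pullback identity for the Ricci tensor shows that the Codazzi expression
    transforms as a tensor, and for constant symbols it vanishes identically. *)
Lemma chart_codazzi j : codazzi 1 C j = 0.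
Proof.
  destruct chart_ricci as [Tr P].
  pose proof (typeA_trace A chart_symmetric) as TA.
  pose proof (typeA_codazzi A i1 chart_symmetric) as C1.
  pose proof (typeA_codazzi A i2 chart_symmetric) as C2.
  pose (J := jac phi 1 0); pose (h := hess C A (/ 1) J).
  assert (K : forall m i j,
    bil (ricci 0 A) (h m i) (J j) + bil (ricci 0 A) (J i) (h m j)
    = -2 * kron m i1 * ricci 1 C i j).
  { intros m i k.
    transitivity (partial m
      (fun x y => bil (ricci 0 A) (jac phi x y i) (jac phi x y k)) 1 0).
    - symmetry; apply partial_unique; unfold bil, sumI.
      eapply is_partial_eq.
      + split_partial; now apply chart_jac_partial.
      + fold J; unfold h; ring.
    - apply partial_unique, (is_partial_ext m U
        (fun x y => / x * / x * ricci 1 C i k)); trivial.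
      + intros u v Huv; symmetry; now apply P.
      + eapply is_partial_eq; [split_partial; lra | rewrite Rinv_1; ring]. }
  pose proof (K i1 i2 j) as K1; pose proof (K i2 i1 j) as K2.
  pose proof chart_symmetric as SA.
  assert (Q : forall i k, ricci 1 C i k = bil (ricci 0 A) (J i) (J k)).
  { intros i k; unfold J; rewrite P, Rinv_1 by easy; ring. }
  unfold codazzi, sumI.
  transitivity (det J * (codazzi 0 A i1 * J j i1 + codazzi 0 A i2 * J j i2));
    [ | rewrite C1, C2; ring].
  (* The term coming from the derivative of [1 / x^2] is traded for Hessian products; the rest is
     polynomial in [C], [A] and [J]. *)
  assert (K3 : -2 * ricci 1 C i2 j
    = bil (ricci 0 A) (h i1 i2) (J j) + bil (ricci 0 A) (J i2) (h i1 j)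
    - (bil (ricci 0 A) (h i2 i1) (J j) + bil (ricci 0 A) (J i1) (h i2 j))).
  { rewrite K1, K2; unfold kron; cbn [idx_eqb]; ring. }
  transitivity (-2 * ricci 1 C i2 j
    - (C i1 j i1 * ricci 1 C i2 i1 + C i1 j i2 * ricci 1 C i2 i2)
    + (C i2 j i1 * ricci 1 C i1 i1 + C i2 j i2 * ricci 1 C i1 i2)); [ring | ].
  rewrite K3, !Q; clear - SA SC TA; clearbody J.
  assert (R12 : ricci 0 A i2 i1 = ricci 0 A i1 i2) by (unfold ricci; lra).
  unfold codazzi, h, hess, bil, sumI, det; rewrite Rinv_1, R12.
  clear h TA R12.
  destruct j; rewrite ?(SC i2 i1), ?(SA i2 i1); ring.
Qed.

Lemma chart_ricci22 : riem 1 C i2 i1 = 0.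
Proof.
  destruct chart_ricci as [Tr P].
  pose proof (typeA_trace A chart_symmetric) as TA.
  apply (flat_conformal_form U phi (ricci 0 A) (ricci 1 C)); trivial.
  - unfold ricci; lra.
  - unfold ricci; lra.
Qed.

End TypeA_chart.

(** * Type A surfaces *)

Lemma typeA_family1 C :
  is_typeB C -> is_typeA half_plane (typeB_christoffel C) -> family1 C.
Proof.
  intros TB TA; destruct (TA (1, 0) half_plane_point)
    as (U & V & phi & A & HU & Hp & Sub & HV & D & I).
  pose proof (proj1 TB : symmetric C) as S.
  assert (ND : forall x y, U (x, y) -> det (jac phi x y) <> 0).
  { intros x y; now apply diffeo_det with V. }
  destruct D as (Sphi & _).
  destruct (codazzi_classification C S (typeB_not_riem_0 C TB)) as [F | F]; trivial.
  - apply (chart_ricci U C A phi); trivial.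
  - now apply (chart_codazzi U C A phi).
  - exfalso.
    pose proof (chart_ricci22 U C A phi HU Hp Sub S Sphi ND I) as Q.
    destruct F as (t & v & He & Hv & E1 & E2 & E3 & E4 & _).
    (* In the second alternative [Q_22] is [C i2 i2 i1 * v], but the chart makes it zero. *)
    apply (Rmult_integral_contrapositive_currified _ _ He Hv).
    rewrite <- Q; unfold riem, sumI; rewrite (S i2 i1), E1, E2, E3, E4; ring.
Qed.

(** The second coordinate solves [x h'' + (2 d - a) h' = b] for [h' = s + r ln x],
    [a = C_11^1], [b = C_11^2], [d = C_12^2]; the logarithmic term is needed only
    in the resonant case [a = 2 d]. *)
Definition log_chart (s r : R) (c : idx) : Defs.scal :=
  match c with
  | i1 => fun x _ => ln x
  | i2 => fun x y => y + (s * x + r * (x * ln x + -1 * x))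
  end.

(** Minus signs are written [-1 *] so that the formulas match the constructors of [elementary]. *)
Definition exp_chart (s r : R) (c : idx) : Defs.scal :=
  match c with
  | i1 => fun u _ => exp u
  | i2 => fun u v => v + -1 * (s * exp u + r * (exp u * u + -1 * exp u))
  end.

Lemma log_chart_diffeo s r : diffeo half_plane (fun _ => True) (log_chart s r).
Proof.
  assert (P : forall x y, half_plane (x, y) -> 0 < x) by easy.
  split; [ | split; [easy | exists (exp_chart s r); split; [ | split; [ | split]]]].
  - intros c; apply elementary_smooth; [apply half_plane_open | ].
    destruct c; simpl; [now apply el_ln | ].
    apply (el_plus _ (fun _ y => y)); [constructor | ].
    apply (el_plus _ (fun x _ => s * x)).
    + apply (el_mult _ (fun _ _ => s) (fun x _ => x)); constructor.
    + apply (el_mult _ (fun _ _ => r)); [constructor | ].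
      apply (el_plus _ (fun x _ => x * ln x) (fun x _ => -1 * x)).
      * now apply (el_mult _ (fun x _ => x) (fun x _ => ln x)); constructor.
      * apply (el_mult _ (fun _ _ => -1) (fun x _ => x)); constructor.
  - intros c; apply elementary_smooth; [apply open_true | ].
    destruct c; simpl; [apply el_exp | ].
    apply (el_plus _ (fun _ y => y)); [constructor | ].
    apply (el_mult _ (fun _ _ => -1)); [constructor | ].
    apply (el_plus _ (fun x _ => s * exp x)).
    + apply (el_mult _ (fun _ _ => s) (fun x _ => exp x)); constructor.
    + apply (el_mult _ (fun _ _ => r)); [constructor | ].
      apply (el_plus _ (fun x _ => exp x * x) (fun x _ => -1 * exp x)).
      * apply (el_mult _ (fun x _ => exp x) (fun x _ => x)); constructor.
      * apply (el_mult _ (fun _ _ => -1) (fun x _ => exp x)); constructor.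
  - intros u v _; apply exp_pos.
  - intros x y Hp; unfold log_chart, exp_chart.
    rewrite exp_ln by exact (P x y Hp); split; ring.
  - intros u v _; unfold log_chart, exp_chart; rewrite ln_exp; split; ring.
Qed.

Lemma log_chart_partial s r i c x y : 0 < x ->
  partial i (log_chart s r c) x y =
  match c, i with i1, i1 => / x | i1, i2 => 0 | i2, i1 => s + r * ln x | i2, i2 => 1 end.
Proof.
  intros H; apply partial_unique; destruct c, i; simpl; auto_derive; trivial;
    try ring; field; lra.
Qed.

Lemma log_chart_partial2 s r i j c x y : 0 < x ->
  partial i (partial j (log_chart s r c)) x y =
  match c, i, j with i1, i1, i1 => - / x * / x | i2, i1, i1 => r * / x | _, _, _ => 0 end.
Proof.
  intros H; apply partial_unique, (is_partial_ext i half_plane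
    (fun x _ => match c, j with
       i1, i1 => / x | i1, i2 => 0 | i2, i1 => s + r * ln x | i2, i2 => 1 end)).
  - apply half_plane_open.
  - exact H.
  - intros u v Huv; now rewrite log_chart_partial.
  - destruct c, i, j; simpl; auto_derive; trivial; try ring; try lra; field; lra.
Qed.

Lemma family1_typeA C :
  symmetric C -> family1 C -> is_typeA half_plane (typeB_christoffel C).
Proof.
  intros S (F1 & F2 & F3) p Hp.
  (* The differential equation for the second coordinate, with [L] standing for [ln x]. *)
  assert (exists s r, forall L,
    (2 * C i1 i2 i2 - C i1 i1 i1) * (s + r * L) + r = C i1 i1 i2) as (s & r & Hsr).
  { destruct (Req_dec (2 * C i1 i2 i2 - C i1 i1 i1) 0) as [Z | NZ].
    - exists 0, (C i1 i1 i2); intros L; rewrite Z; ring.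
    - exists (C i1 i1 i2 / (2 * C i1 i2 i2 - C i1 i1 i1)), 0; intros L.
      field; easy. }
  (* The 1 added to [C i1 i1 i1] comes from the second derivative of [ln]. *)
  exists half_plane, (fun _ => True), (log_chart s r), (fun i j k =>
    match i, j, k with
    | i1, i1, i1 => 1 + C i1 i1 i1
    | i1, i2, i2 | i2, i1, i2 => C i1 i2 i2
    | _, _, _ => 0
    end).
  split; [apply half_plane_open | split; [easy | split; [easy | ]]].
  split; [apply open_true | split; [apply log_chart_diffeo | ]].
  intros i j c x y Hx; change (0 < x) in Hx; unfold sumI, typeB_christoffel.
  rewrite log_chart_partial2, !log_chart_partial by easy.
  destruct c, i, j; rewrite ?(S i2 i1), ?F1, ?F2, ?F3, <- ?(Hsr (ln x)); ring.
Qed.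

Theorem theorem1p13 :
  forall C : typeB_coef, is_typeB C ->
    (strongly_proj_flat half_plane (typeB_christoffel C) <->
     exists C' : typeB_coef,
       is_typeB C' /\ linearly_equiv C C' /\
       (family1 C' \/ exists v : R, family2 v C')) /\
    (family1 C <-> is_typeA half_plane (typeB_christoffel C)).
Proof.
  intros C TB; pose proof (proj1 TB : symmetric C) as S; split; split.
  - intros SPF; destruct (strongly_proj_flat_codazzi C S SPF).
    now apply codazzi_normal_form.
  - intros (C' & [S' _] & L & [F | [v F]]).
    + apply family1_strongly_proj_flat; [easy | ].
      now apply linear_equiv_family1 with C'.
    + now apply family2_strongly_proj_flat with C' v.
  - now apply family1_typeA.
  - now apply typeA_family1.
Qed.
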